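(* Let $q$ be a prime power, $M\ge1$ and $D\ge 1$ integers, $h=(h_0,\dots,h_M)$ a probability vector, and $\bar\eta\in(0,1)$. Let $\hat\theta$ be the optimal value of the optimization problem $$\max\ \theta\quad\text{s.t.}\quad \Omega(x;\Psi)+\theta\ln(1-x)\ge0\ \ (0\le x\le\bar\eta),\qquad \sum_{d=1}^D\Psi_d=1,\quad \Psi_d\ge0\ (d=1,\dots,D),$$ the maximum being over $\theta$ and $\Psi=(\Psi_1,\dots,\Psi_D)$. Then $$\bar\eta\,\hat\theta\le\sum_{r=1}^M r\,\hbar_r .$$
   Context: For integers $m\ge r\ge 0$, $\zeta^m_r=\prod_{i=0}^{r-1}(1-q^{-m+i})$ (equal to $1$ if $r=0$). The effective rank distribution associated with $h$ is $\hbar_r=\sum_{i=r}^M\frac{\zeta^i_r}{q^{i-r}}h_i$, $r=1,\dots,M$. For positive integers $a,b$, $\mathrm{I}_{a,b}(x)=\sum_{j=a}^{a+b-1}\binom{a+b-1}{j}x^j(1-x)^{a+b-1-j}$ is the regularized incomplete beta function. Finally $$\Omega(x;\Psi)=\sum_{r=1}^M\hbar_r\sum_{d=r+1}^D d\Psi_d\,\mathrm{I}_{d-r,r}(x)+\sum_{r=1}^M r\Psi_r\sum_{s=r}^M\hbar_s,$$ with $\Psi_r=0$ for $r>D$ and empty sums equal to $0$. *)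

(* Defs.v *)
From mathcomp Require Import all_boot all_order all_algebra.
From mathcomp Require Import all_classical all_reals all_analysis.

Set Implicit Arguments.
Unset Strict Implicit.
Unset Printing Implicit Defensive.

Import Order.TTheory GRing.Theory Num.Theory.
Local Open Scope classical_set_scope.
Local Open Scope ring_scope.

Definition prime_power (q : nat) : Prop :=
  exists p k : nat, [/\ prime p, (0 < k)%N & q = (p ^ k)%N].

(* The exponent is an integer, so that this is literally q^{-m+i}. *)
Definition zeta (R : realType) (q m r : nat) : R :=
  \prod_(i < r) (1 - q%:R ^ (- m%:Z + i%:Z)).

(* Vectors (h_0, ..., h_M) are sequences of which only the entries of index at
   most M are ever used. *)
Definition probability_vector (R : realType) (M : nat) (h : nat -> R) : Prop :=
  (forall i, (i <= M)%N -> 0 <= h i) /\ \sum_(0 <= i < M.+1) h i = 1.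

Definition hbar (R : realType) (q M : nat) (h : nat -> R) (r : nat) : R :=
  \sum_(r <= i < M.+1) zeta R q i r / q%:R ^+ (i - r) * h i.

(* The regularized incomplete beta function I_{a,b}(x) for integers a, b > 0;
   only used at such a and b. *)
Definition inc_beta (R : realType) (a b : nat) (x : R) : R :=
  \sum_(a <= j < a + b)
    'C((a + b).-1, j)%:R * x ^+ j * (1 - x) ^+ ((a + b).-1 - j).

Definition Omega (R : realType) (q M D : nat) (h Psi : nat -> R) (x : R) : R :=
  \sum_(1 <= r < M.+1)
    hbar q M h r *
      (\sum_(r.+1 <= d < D.+1) d%:R * Psi d * inc_beta (d - r) r x)
  + \sum_(1 <= r < M.+1)
      r%:R * Psi r * (\sum_(r <= s < M.+1) hbar q M h s).

(* (Psi_1, ..., Psi_D) is a sequence extended by Psi_d = 0 for d > D, which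
   matters in Omega when M > D; the entry Psi 0 is never used. *)
Definition degree_distribution (R : realType) (D : nat) (Psi : nat -> R) : Prop :=
  [/\ forall d, (1 <= d <= D)%N -> 0 <= Psi d,
      forall d, (D < d)%N -> Psi d = 0
    & \sum_(1 <= d < D.+1) Psi d = 1].

Definition feasible (R : realType) (q M D : nat) (h : nat -> R) (eta : R)
    (theta : R) (Psi : nat -> R) : Prop :=
  degree_distribution D Psi /\
  forall x : R, 0 <= x <= eta ->
    0 <= Omega q M D h Psi x + theta * ln (1 - x).

(* Supremum in the extended reals, so that an unbounded or infeasible problem
   would get the value +oo or -oo rather than a default real number. *)
Definition optimal_value (R : realType) (q M D : nat) (h : nat -> R) (eta : R)
    : \bar R :=
  ereal_sup [set theta%:E | theta in
    [set theta : R | exists Psi : nat -> R, feasible q M D h eta theta Psi]].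

(* Main.v *)
(** If [P] is nondecreasing on [[0, 1]] and [0 <= P x + theta * ln (1 - x)] on
    [[0, eta]], integrating over [[0, eta]] and adding [(1 - eta)] times the
    inequality at [eta] eliminates the logarithms:
    [eta * theta <= \int_0^eta P + (1 - eta) * P eta <= \int_0^1 P].
    For [P = Omega] the last integral equals
    [\sum_r hbar r * (r * \sum_(d > r) Psi d + \sum_(d <= r) d * Psi d)],
    because [d * I_{d-r,r}] has integral [r]; this is at most
    [\sum_r r * hbar r]. Everything is polynomial apart from the logarithm, so
    explicit antiderivatives in Bernstein form replace integrals. *)

Require Import Defs.
From mathcomp Require Import all_boot all_order all_algebra.
From mathcomp Require Import all_classical all_reals all_analysis.
From mathcomp Require Import ring lra.

Import Order.TTheory GRing.Theory Num.Theory.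
Import numFieldNormedType.Exports.
Local Open Scope classical_set_scope.
Local Open Scope ring_scope.

(** * Polynomials in Bernstein form *)

(* De Casteljau's recursion for [\sum_k c k * 'C(n, k) * X^k * (1 - X)^(n - k)]. *)
Fixpoint bernstein {R : comNzRingType} (n : nat) (c : nat -> R) : {poly R} :=
  if n is m.+1 then
    (1 - 'X) * bernstein m c + 'X * bernstein m (fun k => c k.+1)
  else (c 0%N)%:P.

Lemma bernsteinS (R : comNzRingType) n (c : nat -> R) :
  bernstein n.+1 c =
  (1 - 'X) * bernstein n c + 'X * bernstein n (fun k => c k.+1).
Proof. by []. Qed.

Lemma eq_bernstein (R : comNzRingType) n (c1 c2 : nat -> R) :
  c1 =1 c2 -> bernstein n c1 = bernstein n c2.
Proof.
elim: n c1 c2 => [|n IHn] c1 c2 c12 /=; first by rewrite c12.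
by congr (_ * _ + _ * _); apply: IHn => // k; apply: c12.
Qed.

Lemma bernsteinB (R : comNzRingType) n (c1 c2 : nat -> R) :
  bernstein n (fun k => c1 k - c2 k) = bernstein n c1 - bernstein n c2.
Proof.
elim: n c1 c2 => [|n IHn] c1 c2 /=; first by rewrite polyCB.
by rewrite IHn (IHn (fun k => c1 k.+1) (fun k => c2 k.+1)); ring.
Qed.

(** Pascal's rule splits the binomial sum of degree [n.+1] into the two terms of the recursion. *)
Lemma horner_bernstein (R : comNzRingType) n (c : nat -> R) x :
  (bernstein n c).[x] =
  \sum_(j < n.+1) c j * ('C(n, j)%:R * x ^+ j * (1 - x) ^+ (n - j)).
Proof.
elim: n c => [|n IHn] c /=.
  by rewrite big_ord1 hornerC bin0 !expr0 !mulr1.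
rewrite !hornerE !IHn [RHS]big_ord_recl.
under [X in _ = _ + X]eq_bigr => j _ do
  rewrite lift0 binS natrD subSS 2!mulrDl mulrDr.
rewrite big_split /= addrA; congr (_ + _); last first.
  by rewrite mulr_sumr; apply: eq_bigr => j _; rewrite exprS; ring.
rewrite [X in _ = _ + X]big_ord_recr /= (bin_small (ltnSn n)) !mul0r mulr0 addr0.
rewrite mulr_sumr big_ord_recl !bin0 !subn0; congr (_ + _).
  by rewrite [in RHS]exprS; ring.
apply: eq_bigr => j _; rewrite lift0.
by rewrite -(subnSK (ltn_ord j)) (exprS _ (n - j.+1)); ring.
Qed.

Lemma bernstein_at0 (R : comNzRingType) n (c : nat -> R) :
  (bernstein n c).[0] = c 0%N.
Proof.
elim: n c => [|n IHn] c /=; first by rewrite hornerC.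
by rewrite !hornerE IHn; ring.
Qed.

Lemma bernstein_at1 (R : comNzRingType) n (c : nat -> R) :
  (bernstein n c).[1] = c n.
Proof.
elim: n c => [|n IHn] c /=; first by rewrite hornerC.
by rewrite !hornerE !IHn; ring.
Qed.

Lemma bernstein_ge0 (R : realDomainType) n (c : nat -> R) x :
  (forall k, 0 <= c k) -> 0 <= x <= 1 -> 0 <= (bernstein n c).[x].
Proof.
move=> c0 /andP[x0 x1]; elim: n c c0 => [|n IHn] c c0 /=.
  by rewrite hornerC.
by rewrite !hornerE addr_ge0 // mulr_ge0 ?subr_ge0 ?IHn.
Qed.

(** In the product rule, differentiating the weights [1 - 'X] and ['X] yields one more copy of the
    Bernstein form of the differences, so the factor grows by one per degree. *)
Lemma deriv_bernstein (R : comNzRingType) n (c : nat -> R) :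
  (bernstein n.+1 c)^`() = bernstein n (fun k => c k.+1 - c k) *+ n.+1.
Proof.
elim: n c => [|n IHn] c.
  by rewrite /= polyCB !poly.derivE; ring.
rewrite bernsteinS derivD (derivM (1 - 'X)) (derivM 'X) !IHn derivB derivX derivC.
have /eqP := bernsteinB _ n.+1 (fun k => c k.+1) c.
by rewrite bernsteinS eq_sym subr_eq => /eqP ->; ring.
Qed.

(** * Truncated ramps and the incomplete beta function *)

(** Subtraction in [nat] truncates, so this is the convex sequence [max(k - a, 0)]. *)
Definition trunc_ramp {R : nzRingType} (a k : nat) : R := (k - a)%:R.

Lemma trunc_ramp_diff (R : nzRingType) a k :
  trunc_ramp a k.+1 - trunc_ramp a k = (a <= k)%:R :> R.
Proof.
rewrite /trunc_ramp; case: leqP => ak; first by rewrite subSn // mulrSr addrC addKr.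
by move/eqP: (ltnW ak) => ->; move/eqP: ak => ->; rewrite subrr.
Qed.

Lemma deriv_bernstein_trunc_ramp (R : realType) (r d : nat) (x : R) :
  (0 < r < d)%N ->
  ((bernstein d (trunc_ramp (d - r)))^`()).[x] =
  d%:R * inc_beta (d - r) r x.
Proof.
case: d => [|d]; first by rewrite ltn0 andbF.
move=> /andP[r0 rd]; rewrite deriv_bernstein hornerMn -mulr_natl; congr (_ * _).
(* The differences of the ramp are the indicator of [d.+1 - r <= k], which cuts the binomial sum
   down to the tail [inc_beta]. *)
rewrite (@eq_bernstein _ _ _ (fun k => (d.+1 - r <= k)%:R)); last first.
  by move=> k; exact: trunc_ramp_diff.
rewrite horner_bernstein /inc_beta subnK ?(ltnW rd)//=.
rewrite (big_nat_widenl (d.+1 - r) 0) // big_mkord [RHS]big_mkcond /=.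
by apply: eq_bigr => j _; case: leqP => _; rewrite ?mul1r ?mul0r.
Qed.

(** The coefficients are second differences of the ramp, nonnegative because the indicator of
    [a <= k] is nondecreasing in [k]. *)
Lemma deriv2_bernstein_trunc_ramp_ge0 (R : realType) (a d : nat) (x : R) :
  0 <= x <= 1 -> 0 <= ((bernstein d (trunc_ramp a))^`()^`()).[x].
Proof.
case: d => [|[|d]] x01; first by rewrite /= !poly.derivE horner0.
  by rewrite deriv_bernstein mulr1n /= derivC horner0.
rewrite deriv_bernstein derivMn deriv_bernstein !hornerMn.
rewrite 2?mulrn_wge0 // bernstein_ge0 // => k.
rewrite !trunc_ramp_diff subr_ge0 ler_nat.
by case: (leqP a k) => // ak; rewrite (leqW ak).
Qed.

(** * Elimination of the logarithm *)

Lemma deriv_ge0_le_horner (R : realType) (p : {poly R}) (a b : R) :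
  a <= b -> (forall x, a <= x <= b -> 0 <= p^`().[x]) -> p.[a] <= p.[b].
Proof.
move=> ab p'0; rewrite -subr_ge0.
have dp x : x \in `]a, b[ -> is_derive x 1 (horner p) p^`().[x].
  by move=> _; exact: is_derive_poly.
have cp : {within `[a, b], continuous (horner p)}.
  apply: derivable_within_continuous => x _.
  by case: (is_derive_poly p x).
have [c cab ->] := MVT_segment ab dp cp.
by rewrite mulr_ge0 ?subr_ge0 // p'0.
Qed.

Lemma log_area_bound (R : realType) (F : {poly R}) (eta theta : R) :
  0 < eta < 1 ->
  (forall x, 0 <= x <= 1 -> 0 <= F^`()^`().[x]) ->
  (forall x, 0 <= x <= eta -> 0 <= F^`().[x] + theta * ln (1 - x)) ->
  eta * theta <= F.[1] - F.[0].
Proof.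
move=> /andP[eta0 eta1] F''0 F'ln.
have right_part : F.[eta] + (1 - eta) * F^`().[eta] <= F.[1].
  (* [G.[x]] is the value at 1 of the tangent to [F] at [x]; convexity makes it nondecreasing in
     [x]. *)
  pose G := F + (1 - 'X) * F^`().
  have : G.[eta] <= G.[1].
    apply: deriv_ge0_le_horner => [|x /andP[ex x1]]; first exact: ltW.
    have -> : G^`() = (1 - 'X) * F^`()^`().
      by rewrite /G !poly.derivE; ring.
    rewrite !hornerE mulr_ge0 ?subr_ge0 // F''0 // x1 andbT.
    exact: le_trans (ltW eta0) ex.
  by rewrite /G !hornerE subrr mul0r addr0.
have left_part :
    0 <= F.[eta] - F.[0] - theta * ((1 - eta) * ln (1 - eta) + eta).
  pose u : {poly R} := 1 - 'X.
  (* A primitive of [F' + theta * ln (1 - x)], since [- (1 - x) * ln (1 - x) - x] is one of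
     [ln (1 - x)]. *)
  pose g := horner (F - theta *: 'X) - horner (theta *: u) * (@ln R \o horner u).
  have gE x : g x = F.[x] - theta * ((1 - x) * ln (1 - x) + x).
    rewrite /g /u !fctE /= !hornerE; ring.
  have dg x : x <= eta -> is_derive x 1 g (F^`().[x] + theta * ln (1 - x)).
    move=> xe; have x1 : 0 < 1 - x by rewrite subr_gt0 (le_lt_trans xe).
    have du := is_derive_poly u x; have dtu := is_derive_poly (theta *: u) x.
    have dp := is_derive_poly (F - theta *: 'X) x.
    have dln : is_derive x 1 (@ln R \o horner u) ((1 - x)^-1 * u^`().[x]).
      by apply: is_derive1_comp; rewrite /u !hornerE; exact: is_derive1_ln.
    apply: is_derive_eq.
    rewrite /u !poly.derivE !hornerE /= !hornerE /GRing.scale /=.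
    field; exact: lt0r_neq0.
  have dg_oo x : x \in `]0, eta[ ->
      is_derive x 1 g (F^`().[x] + theta * ln (1 - x)).
    by rewrite in_itv => /andP[_ /ltW xe]; exact: dg.
  have cg : {within `[0, eta], continuous g}.
    apply: derivable_within_continuous => x; rewrite in_itv => /andP[_ xe].
    by case: (dg x xe).
  have [c c0e] := MVT_segment (ltW eta0) dg_oo cg.
  rewrite !gE subr0 ln1 mulr0 addr0 mulr0 !subr0 addrAC => ->.
  by rewrite mulr_ge0 ?(ltW eta0) // F'ln.
have at_eta : 0 <= (1 - eta) * (F^`().[eta] + theta * ln (1 - eta)).
  by rewrite mulr_ge0 ?subr_ge0 ?(ltW eta1) // F'ln // lexx ltW.
(* The terms in [theta * (1 - eta) * ln (1 - eta)] cancel between [left_part] and [at_eta]. *)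
lra.
Qed.

(** * Nonnegativity of the effective rank distribution *)

(** For [i < r <= m] the exponent [- m + i] is negative, so the power of [q >= 1] is at most 1. *)
Lemma zeta_ge0 (R : realType) (q m r : nat) :
  (0 < q)%N -> (r <= m)%N -> 0 <= zeta R q m r.
Proof.
move=> q0 rm; apply: prodr_ge0 => i _; rewrite subr_ge0.
have im : (i <= m)%N by apply: ltnW; apply: leq_trans rm.
have -> : - m%:Z + i%:Z = - (m - i)%N%:Z by rewrite -subzn // opprB addrC.
by rewrite -exprz_inv -exprnP exprVn invf_le1 ?exprn_ege1 ?exprn_gt0 ?ltr0n ?ler1n.
Qed.

Lemma hbar_ge0 (R : realType) (q M : nat) (h : nat -> R) r :
  (0 < q)%N -> (forall i, (i <= M)%N -> 0 <= h i) -> 0 <= hbar q M h r.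
Proof.
move=> q0 h0; rewrite /hbar big_nat_cond sumr_ge0 // => i.
rewrite andbT ltnS => /andP[ri iM].
by rewrite mulr_ge0 ?h0 // divr_ge0 ?zeta_ge0 // exprn_ge0.
Qed.

(** * A convex polynomial primitive of [Omega] *)

Lemma exchange_sum_triangle (R : nmodType) (n : nat) (F : nat -> nat -> R) :
  \sum_(1 <= r < n.+1) \sum_(r <= s < n.+1) F r s =
  \sum_(1 <= s < n.+1) \sum_(1 <= r < s.+1) F r s.
Proof.
under eq_big_nat => r /andP[r1 _] do rewrite (big_nat_widenl r 1) //.
rewrite (exchange_big_dep_nat predT) //=.
apply: eq_big_nat => s /andP[_ sn].
by rewrite (big_nat_widen 1 s.+1 n.+1).
Qed.

Lemma deriv_sum (R : nzSemiRingType) (I : Type) (s : seq I) (P : pred I)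
    (F : I -> {poly R}) :
  (\sum_(i <- s | P i) F i)^`() = \sum_(i <- s | P i) (F i)^`().
Proof. exact: raddf_sum. Qed.

Definition Omega_primitive {R : realType} (q M D : nat) (h Psi : nat -> R)
    : {poly R} :=
  \sum_(1 <= r < M.+1) hbar q M h r *:
    (\sum_(r.+1 <= d < D.+1) Psi d *: bernstein d (trunc_ramp (d - r)))
  + (\sum_(1 <= r < M.+1)
      r%:R * Psi r * (\sum_(r <= s < M.+1) hbar q M h s)) *: 'X.

Lemma horner_deriv_Omega_primitive (R : realType) q M D (h Psi : nat -> R) x :
  (Omega_primitive q M D h Psi)^`().[x] = Omega q M D h Psi x.
Proof.
rewrite /Omega_primitive /Omega !poly.derivE hornerD; congr (_ + _); last first.
  by rewrite !hornerE.
rewrite deriv_sum horner_sum; apply: eq_big_nat => r /andP[r1 _].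
rewrite derivZ hornerZ; congr (_ * _).
rewrite deriv_sum horner_sum; apply: eq_big_nat => d /andP[rd _].
by rewrite derivZ hornerZ deriv_bernstein_trunc_ramp ?r1 //; ring.
Qed.

Lemma Omega_primitive_convex (R : realType) q M D (h Psi : nat -> R) x :
  (0 < q)%N -> (forall i, (i <= M)%N -> 0 <= h i) ->
  degree_distribution D Psi -> 0 <= x <= 1 ->
  0 <= (Omega_primitive q M D h Psi)^`()^`().[x].
Proof.
move=> q0 h0 [Psi0 _ _] x01.
rewrite /Omega_primitive !poly.derivE hornerD hornerZ horner0 mulr0 addr0.
rewrite !deriv_sum horner_sum sumr_ge0 // => r _.
rewrite !derivZ hornerZ mulr_ge0 ?hbar_ge0 // !deriv_sum horner_sum.
rewrite big_nat_cond sumr_ge0 // => d; rewrite andbT => /andP[rd dD].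
rewrite !derivZ hornerZ mulr_ge0 ?deriv2_bernstein_trunc_ramp_ge0 //.
by rewrite Psi0 // (leq_ltn_trans (leq0n r) rd).
Qed.

Lemma Omega_primitive_increment (R : realType) q M D (h Psi : nat -> R) :
  (Omega_primitive q M D h Psi).[1] - (Omega_primitive q M D h Psi).[0] =
  \sum_(1 <= r < M.+1) hbar q M h r *
    (r%:R * \sum_(r.+1 <= d < D.+1) Psi d + \sum_(1 <= d < r.+1) d%:R * Psi d).
Proof.
rewrite /Omega_primitive !hornerD !hornerZ !hornerX mulr0 mulr1 addr0 addrAC.
rewrite !horner_sum -sumrB.
under [X in _ + X = _]eq_bigr do rewrite mulr_sumr.
(* Exchanging the sums collects the constant part of [Omega] by [hbar], to match the first part. *)
rewrite exchange_sum_triangle -big_split /=.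
apply: eq_big_nat => r /andP[r1 _].
rewrite !hornerZ !horner_sum -mulrBr -sumrB mulrDr; congr (_ * _ + _); last first.
  by rewrite mulr_sumr; apply: eq_bigr => d _; rewrite mulrC.
rewrite mulr_sumr; apply: eq_big_nat => d /andP[rd _].
(* The ramp is 0 at index 0 and [d - (d - r) = r] at index [d]. *)
rewrite !hornerZ bernstein_at0 bernstein_at1 /trunc_ramp sub0n mulr0 subr0.
by rewrite subKn 1?ltnW // mulrC.
Qed.

(** * The bound for feasible points and for the supremum *)

Lemma feasible_bound (R : realType) (q M D : nat) (h Psi : nat -> R)
    (eta theta : R) :
  (0 < q)%N -> (forall i, (i <= M)%N -> 0 <= h i) -> 0 < eta < 1 ->
  feasible q M D h eta theta Psi ->
  eta * theta <= \sum_(1 <= r < M.+1) r%:R * hbar q M h r.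
Proof.
move=> q0 h0 eta01 [HPsi Hfeas].
apply: (@le_trans _ _ ((Omega_primitive q M D h Psi).[1] -
                       (Omega_primitive q M D h Psi).[0])).
  apply: log_area_bound => // x x01; first exact: Omega_primitive_convex.
  by rewrite horner_deriv_Omega_primitive Hfeas.
rewrite Omega_primitive_increment; apply: ler_sum => r _.
rewrite [leRHS]mulrC ler_wpM2l ?hbar_ge0 //.
case: HPsi => Psi0 PsiD Psi1.
have Psi_ge0 d : (0 < d)%N -> 0 <= Psi d.
  by move=> d0; case: (leqP d D) => dD; [rewrite Psi0 ?d0 | rewrite PsiD].
have mass : \sum_(r.+1 <= d < D.+1) Psi d + \sum_(1 <= d < r.+1) Psi d = 1.
  rewrite addrC -Psi1; case: (leqP r D) => rD; first by rewrite -big_cat_nat.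
  (* If [D < r], the first sum is empty and the entries of the second beyond [D] vanish. *)
  rewrite (@big_geq _ _ _ r.+1) ?addr0; last by rewrite ltnS ltnW.
  rewrite (@big_cat_nat _ _ _ D.+1) ?ltnS //=; last by rewrite ltnW.
  rewrite [X in _ + X]big_nat_cond [X in _ + X]big1 ?addr0 // => d.
  by rewrite andbT => /andP[/PsiD].
(* Spreading [r] over the total mass 1 leaves only [d * Psi d <= r * Psi d] for [d <= r]. *)
rewrite -[leRHS]mulr1 -[X in _ <= _ * X]mass mulrDr lerD2l mulr_sumr.
rewrite big_nat_cond [leRHS]big_nat_cond; apply: ler_sum => d.
rewrite andbT ltnS => /andP[d1 dr].
by rewrite ler_wpM2r ?Psi_ge0 // ler_nat.
Qed.

Theorem theorem4 (R : realType) (q M D : nat) (h : nat -> R) (eta : R)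
    (hq : prime_power q) (hM : (1 <= M)%N) (hD : (1 <= D)%N)
    (hh : probability_vector M h) (heta : 0 < eta < 1) :
  (eta%:E * optimal_value q M D h eta
     <= (\sum_(1 <= r < M.+1) r%:R * hbar q M h r)%:E)%E.
Proof.
have q0 : (0 < q)%N.
  by case: hq => p [k [p_prime _ ->]]; rewrite expn_gt0 prime_gt0.
have [h0 _] := hh; have [eta0 _] := andP heta.
(* Dividing by [eta > 0] in the extended reals turns the claim into an upper bound on each feasible
   [theta]. *)
rewrite -lee_pdivlMl //; apply: ge_ereal_sup => _ [theta [Psi Hfeas] <-].
by rewrite lee_pdivlMl // -EFinM lee_fin; apply: feasible_bound Hfeas.
Qed.
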